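(* Let $N\ge2$ and let $\Omega_1\ge\dots\ge\Omega_N$ be real numbers, not all zero, with $\sum_j\Omega_j=0$. For $\kappa\ge\kappa^*$ (see context), the order parameter norm of the synchronized (phase-locked) state satisfies $\lambda=\|\zeta_\infty\|_2\ge\frac{\sqrt2}{2}$, and its angle of opening satisfies $$\alpha_1-\alpha_N\le2\cos^{-1}\left(\frac{-N+2+\sqrt{N^2-4N+36}}{8}\right).$$ Further, at the maximal angle of opening the value $\lambda^*$ (the order parameter norm at $\kappa=\kappa^*$) is $$\lambda^*=\frac{3(N-2)+\sqrt{N^2-4N+36}}{4N}.$$
   Context: A phase-locked state at coupling $\kappa>0$ consists of angles $\alpha_j$ with $\cos\alpha_j\ge0$ and $\lambda>0$ such that $$\Omega_j=\lambda\kappa\sin\alpha_j,\qquad\lambda=\frac1N\sum_{l=1}^N\cos\alpha_l,\qquad\frac1N\sum_{l=1}^N\sin\alpha_l=0;$$ it corresponds to the fixed point $z_{jk}=e^{i(\alpha_j-\alpha_k)}$ of the Schrödinger-Lohe correlation system $\dot z_{jk}=i(\Omega_j-\Omega_k)z_{jk}+\frac{\kappa}{2N}\sum_l(z_{jl}+z_{lk})(1-z_{jk})$, with $\lambda=\|\zeta_\infty\|_2$ the norm of the order parameter $\zeta_\infty$. Only the stable branch is considered: the branch, defined for $\kappa\ge\kappa^*$, along which $\lambda$ increases with $\kappa$, with $\lambda\to1$, $\alpha_j\to0$ as $\kappa\to\infty$. The critical coupling $\kappa^*$ where the branch begins is characterized by the phase-locked state at $\kappa=\kappa^*$ satisfying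 $$\lambda=\frac1N\sum_{j=1}^N\cos\alpha_j=\frac1{2N}\sum_{j=1}^N\frac1{\cos\alpha_j}=:\lambda^*.$$ ''At the maximal angle of opening'' means for a configuration $(\Omega_j)$ for which, at $\kappa=\kappa^*$, equality holds in the bound on $\alpha_1-\alpha_N$. *)

(* Defs.v *)
From mathcomp Require Import all_boot all_order all_algebra.
From mathcomp Require Import complex.
From mathcomp Require Import all_classical all_reals all_analysis.

Set Implicit Arguments.
Unset Strict Implicit.
Unset Printing Implicit Defensive.

Import Order.TTheory GRing.Theory Num.Theory.
Import numFieldNormedType.Exports.

Local Open Scope classical_set_scope.
Local Open Scope ring_scope.

(* An angle with nonnegative cosine is identified with its representative in
   [-pi/2, pi/2]; this is what gives differences of angles their meaning as
   real numbers. *)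
Definition phase_locked (R : realType) (N : nat) (Omega : 'I_N -> R)
    (kappa : R) (alpha : 'I_N -> R) (lambda : R) : Prop :=
  [/\ 0 < lambda,
      forall j, - (pi / 2) <= alpha j <= pi / 2 /\ 0 <= cos (alpha j),
      forall j, Omega j = lambda * kappa * sin (alpha j),
      lambda = N%:R^-1 * \sum_(l < N) cos (alpha l) &
      N%:R^-1 * \sum_(l < N) sin (alpha l) = 0].

(* Since x^-1 = 0 for x = 0, the cosines must be required to be nonzero for the
   second equation to have its intended meaning. *)
Definition critical_state (R : realType) (N : nat) (alpha : 'I_N -> R)
    (lambda : R) : Prop :=
  [/\ forall j, cos (alpha j) != 0,
      lambda = N%:R^-1 * \sum_(j < N) cos (alpha j) &
      lambda = (2 * N%:R)^-1 * \sum_(j < N) (cos (alpha j))^-1].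

(* Only the values of alpha and lambda at kappa >= kappas are meaningful. *)
Definition stable_branch (R : realType) (N : nat) (Omega : 'I_N -> R)
    (kappas : R) (alpha : R -> 'I_N -> R) (lambda : R -> R) : Prop :=
  0 < kappas /\
  (forall kappa, kappas <= kappa ->
     phase_locked Omega kappa (alpha kappa) (lambda kappa)) /\
  (forall kappa1 kappa2, kappas <= kappa1 -> kappa1 < kappa2 ->
     lambda kappa1 < lambda kappa2) /\
  lambda kappa @[kappa --> +oo] --> (1 : R) /\
  (forall j, alpha kappa j @[kappa --> +oo] --> (0 : R)) /\
  critical_state (alpha kappas) (lambda kappas).

Definition correlation (R : realType) (N : nat) (alpha : 'I_N -> R)
    (j k : 'I_N) : R[i] :=
  Complex (cos (alpha j - alpha k)) (sin (alpha j - alpha k)).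

(* The order parameter is the mean zeta = (1/N) sum_j psi_j of the wave
   functions, and z_jk = <psi_j, psi_k>, so that
   ||zeta||^2 = (1/N^2) sum_(j,k) z_jk. *)
Definition order_parameter_norm (R : realType) (N : nat)
    (z : 'I_N -> 'I_N -> R[i]) : R :=
  Num.sqrt (complex.Re (\sum_(j < N) \sum_(k < N) z j k) / N%:R ^+ 2).

(* Main.v *)
Require Import Defs.
From mathcomp Require Import all_boot all_order all_algebra.
From mathcomp Require Import all_classical all_reals all_analysis.
From mathcomp Require Import complex ring lra.

Set Implicit Arguments.
Unset Strict Implicit.
Unset Printing Implicit Defensive.

Import Order.TTheory GRing.Theory Num.Theory.
Import numFieldNormedType.Exports.

Local Open Scope ring_scope.

(** Write c_j for the cosines at the critical coupling, so that
  sum_j (1 / c_j - 2 c_j) = 0. The estimate 1 / c >= 2 - c, valid for c > 0,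
  bounds each term by -1 from below when c <= 1; applied to all indices except
  the two extreme ones it gives 4 / s <= 2 s + N - 2, where s = c_1 + c_N, and
  s <= 2 cos d, where d is half the angle of opening. Hence
  4 cos^2 d + (N - 2) cos d >= 2, which is the bound on the opening, and
  equality forces all the other cosines to be 1. The bound on lambda follows
  from the other tangents 1 / c >= 2 t - t^2 c, at t = sqrt 2. For larger kappa
  both lambda and lambda kappa are larger, so that the sines, hence the opening,
  shrink. *)

Lemma Re_sum (R : rcfType) (I : Type) (r : seq I) (P : pred I) (F : I -> R[i]) :
  complex.Re (\sum_(i <- r | P i) F i) = \sum_(i <- r | P i) complex.Re (F i).
Proof. by apply: (big_morph (@complex.Re R)) => // -[? ?] [? ?]. Qed.

(** The double sum of the entries exp(i (alpha_j - alpha_k)) factors as the squared modulus of sum_j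
    exp(i alpha_j). *)
Lemma order_parameter_norm_correlation (R : realType) (N : nat)
    (alpha : 'I_N -> R) :
  order_parameter_norm (correlation alpha) =
    Num.sqrt ((N%:R^-1 * \sum_j cos (alpha j)) ^+ 2 +
              (N%:R^-1 * \sum_j sin (alpha j)) ^+ 2).
Proof.
rewrite /order_parameter_norm; congr Num.sqrt.
rewrite !exprMn -mulrDr mulrC exprVn; congr (_ * _).
rewrite !expr2 !mulr_suml -big_split Re_sum; apply: eq_bigr => j _.
rewrite Re_sum !mulr_sumr -big_split; apply: eq_bigr => k _ /=.
exact: cosB.
Qed.

(** For t > 0 the left side is the tangent line of the convex function 1 / c at c = 1 / t; the gap
    is (1 - t c)^2 / c. *)
Lemma invr_tangent_ge (R : realFieldType) (t c : R) :
  0 < c -> 2 * t - t ^+ 2 * c <= c^-1.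
Proof.
move=> c0; rewrite -subr_ge0.
have -> : c^-1 - (2 * t - t ^+ 2 * c) = c^-1 * (1 - t * c) ^+ 2.
  by field; rewrite gt_eqF.
by rewrite mulr_ge0 ?sqr_ge0 ?invr_ge0 ?ltW.
Qed.

(** The sum equals 2 cos m cos d with m the mean and d half the difference; d stays in
    [-pi/2, pi/2], so cos d >= 0 and cos m can be replaced by 1. *)
Lemma add_cos_le_half_opening (R : realType) (a b : R) :
  - (pi / 2) <= a <= pi / 2 -> - (pi / 2) <= b <= pi / 2 ->
  cos a + cos b <= 2 * cos ((a - b) / 2).
Proof.
move=> ha hb; set d := (a - b) / 2; pose m := (a + b) / 2.
have -> : a = m + d by rewrite /m /d; lra.
have -> : b = m - d by rewrite /m /d; lra.
rewrite cosD cosB.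
have d0 : 0 <= cos d by apply: cos_ge0_pihalf; rewrite /d; lra.
have := cos_le1 m; nra.
Qed.

Lemma ler_sin_pihalf (R : realType) (x y : R) :
  - (pi / 2) <= x <= pi / 2 -> - (pi / 2) <= y <= pi / 2 ->
  (sin x <= sin y) = (x <= y).
Proof.
by move=> hx hy; rewrite !leNgt ltr_sin ?in_itv.
Qed.

Section CriticalState.
Variables (R : realType) (N : nat) (alpha : 'I_N -> R) (lambda : R).
Hypothesis N_gt0 : (0 < N)%N.
Hypothesis alpha_pihalf : forall j, - (pi / 2) <= alpha j <= pi / 2.
Hypothesis crit : critical_state alpha lambda.

Let nR : 0 < N%:R :> R. Proof. by rewrite ltr0n. Qed.

Lemma critical_cos_gt0 j : 0 < cos (alpha j).
Proof.
by rewrite lt_neqAle eq_sym; case: crit => -> _ _ /=; apply: cos_ge0_pihalf.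
Qed.

Lemma critical_sum_cos : \sum_j cos (alpha j) = N%:R * lambda.
Proof.
by case: crit => _ -> _; rewrite mulrA mulfV ?mul1r ?gt_eqF.
Qed.

Lemma critical_sum_inv_cos : \sum_j (cos (alpha j))^-1 = 2 * N%:R * lambda.
Proof.
case: crit => _ _ ->; rewrite mulrA mulfV ?mul1r // gt_eqF //.
by rewrite mulr_gt0.
Qed.

Lemma critical_lambda_ge : Num.sqrt 2 / 2 <= lambda.
Proof.
(* The tangency point 1 / t solves 1 / c = 2 c, where the critical equation holds term by term. *)
pose t : R := Num.sqrt 2.
have t2 : t ^+ 2 = 2 by apply: sqr_sqrtr.
have : \sum_j (2 * t - t ^+ 2 * cos (alpha j)) <= \sum_j (cos (alpha j))^-1.
  by apply: ler_sum => j _; apply: invr_tangent_ge; exact: critical_cos_gt0.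
rewrite critical_sum_inv_cos sumrB sumr_const card_ord.
rewrite -mulr_sumr critical_sum_cos t2 -[_ *+ N]mulr_natr -/t => H.
have : N%:R * (2 * t) <= N%:R * (4 * lambda) by lra.
by rewrite ler_pM2l // => ?; lra.
Qed.

(* The right-hand side keeps the defect [N - 2 - (N lambda - s) >= 0] of the
   remaining cosines, which has to vanish in the equality case. *)
Lemma critical_pair (i k : 'I_N) : i != k ->
  let s := cos (alpha i) + cos (alpha k) in
  let defect := N%:R - 2 - (N%:R * lambda - s) in
  0 <= defect /\ 4 <= s * (2 * s + (N%:R - 2) - 3 * defect).
Proof.
move=> ik s defect; have ki : k != i by rewrite eq_sym.
have ci := critical_cos_gt0 i; have ck := critical_cos_gt0 k.
have split (F : 'I_N -> R) :
    \sum_j F j = F i + F k + \sum_(j | (j != i) && (j != k)) F j.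
  by rewrite (bigD1 i) //= (bigD1 k) //= addrA.
have := split (fun=> 1); rewrite sumr_const card_ord => h1.
have := split (fun j => cos (alpha j)); rewrite critical_sum_cos => hc.
have := split (fun j => (cos (alpha j))^-1); rewrite critical_sum_inv_cos => hv.
have le1 : \sum_(j | (j != i) && (j != k)) cos (alpha j)
    <= \sum_(j | (j != i) && (j != k)) 1.
  by apply: ler_sum => j _; exact: cos_le1.
have lev : \sum_(j | (j != i) && (j != k)) (2 * 1 - cos (alpha j))
    <= \sum_(j | (j != i) && (j != k)) (cos (alpha j))^-1.
  apply: ler_sum => j _.
  have := @invr_tangent_ge R 1 _ (critical_cos_gt0 j).
  by rewrite expr1n mul1r.
rewrite sumrB -mulr_sumr in lev.
have s0 : 0 < s by apply: addr_gt0.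
(* The inequality between the arithmetic and harmonic means of the two cosines. *)
have harm : 4 <= s * ((cos (alpha i))^-1 + (cos (alpha k))^-1).
  rewrite -subr_ge0.
  have -> : s * ((cos (alpha i))^-1 + (cos (alpha k))^-1) - 4 =
      (cos (alpha i) - cos (alpha k)) ^+ 2 *
      ((cos (alpha i))^-1 * (cos (alpha k))^-1).
    by rewrite /s; field; rewrite !gt_eqF.
  by rewrite mulr_ge0 ?sqr_ge0 ?mulr_ge0 ?invr_ge0 ?ltW.
split; first by rewrite /defect /s; lra.
(* The other cosines sum to N - 2 - [defect]. This costs 2 [defect] in twice the total of the
   cosines, and one more in the lower bound [lev] on the other inverses. *)
apply: (le_trans harm); rewrite ler_pM2l // /defect /s; lra.
Qed.

Let c0 : R := (- N%:R + 2 + Num.sqrt (N%:R ^+ 2 - 4 * N%:R + 36)) / 8.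

(** The radicand is (N - 2)^2 + 32, the discriminant of 4 x^2 + (N - 2) x - 2, and its square root
    exceeds |N - 2|. *)
Lemma critical_root : 0 < c0 /\ 4 * c0 ^+ 2 + (N%:R - 2) * c0 = 2.
Proof.
pose r : R := Num.sqrt (N%:R ^+ 2 - 4 * N%:R + 36).
have disc : N%:R ^+ 2 - 4 * N%:R + 36 = (N%:R - 2) ^+ 2 + 32 :> R by ring.
have r2 : r ^+ 2 = (N%:R - 2) ^+ 2 + 32.
  by rewrite sqr_sqrtr disc // addr_ge0 ?sqr_ge0.
have r0 : 0 <= r by exact: sqrtr_ge0.
rewrite /c0 -/r; split; last by field: r2.
by rewrite divr_gt0 //; nra.
Qed.

Lemma critical_half_opening (i k : 'I_N) : (1 < N)%N -> i != k ->
  c0 <= cos ((alpha i - alpha k) / 2) /\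
  (cos ((alpha i - alpha k) / 2) = c0 -> N%:R * lambda = 2 * c0 + (N%:R - 2)).
Proof.
move=> N1 ik; have [c0_gt0 c0E] := critical_root.
have n2 : 2 <= N%:R :> R by rewrite (ler_nat R 2 N).
have sle : cos (alpha i) + cos (alpha k) <= 2 * cos ((alpha i - alpha k) / 2).
  exact: add_cos_le_half_opening.
have [] := critical_pair ik.
have := addr_gt0 (critical_cos_gt0 i) (critical_cos_gt0 k).
set s := cos (alpha i) + cos (alpha k) in sle *; set d := cos _ in sle *.
set e := N%:R - 2 - (N%:R * lambda - s) => s0 e0 H.
have Hs : 4 <= s * (2 * s + (N%:R - 2)) by nra.
(* The product s (2 s + N - 2) increases with s > 0 and equals 4 at s = 2 [c0], by [c0E]. *)
have sge : 2 * c0 <= s.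
  rewrite leNgt; apply/negP => sc.
  have : s * (2 * s + (N%:R - 2)) < 2 * c0 * (2 * (2 * c0) + (N%:R - 2)).
    by apply: ltr_pM => //; lra.
  lra.
split=> [|dE]; first lra.
have sE : s = 2 * c0 by apply/eqP; rewrite eq_le sge andbT -dE.
(* At s = 2 [c0] the bound [H] is already tight without the defect, so nothing is left for [e]. *)
have : s * (3 * e) <= 0 by rewrite sE in H *; lra.
rewrite pmulr_rle0 // => e1; have : e = 0 by lra.
rewrite /e sE; lra.
Qed.

End CriticalState.

(** A larger product of lambda and kappa pulls every angle towards 0, from the side given by the
    sign of [Omega j]. *)
Lemma phase_locked_angle_shrink (R : realType) (N : nat) (Omega : 'I_N -> R)
    (kappa1 kappa2 : R) (alpha1 alpha2 : 'I_N -> R) (lambda1 lambda2 : R) :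
  phase_locked Omega kappa1 alpha1 lambda1 ->
  phase_locked Omega kappa2 alpha2 lambda2 ->
  0 < kappa1 -> kappa1 <= kappa2 -> lambda1 <= lambda2 ->
  forall j, (0 <= Omega j -> alpha2 j <= alpha1 j) /\
            (Omega j <= 0 -> alpha1 j <= alpha2 j).
Proof.
move=> [l1 a1 O1 _ _] [l2 a2 O2 _ _] k1 k12 l12 j.
have p1 : 0 < lambda1 * kappa1 by rewrite mulr_gt0.
have p12 : lambda1 * kappa1 <= lambda2 * kappa2 by apply: ler_pM => //; lra.
rewrite -(ler_sin_pihalf (a2 j).1 (a1 j).1) -(ler_sin_pihalf (a1 j).1 (a2 j).1).
have := O2 j; rewrite O1 => E.
have p2 : 0 < lambda2 * kappa2 by lra.
split=> [|]; rewrite ?pmulr_rge0 ?pmulr_rle0 // => s1;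
  rewrite -(ler_pM2l p2) -E; nra.
Qed.


Theorem lemma6p3 (R : realType) (N : nat) (hN : (2 <= N)%N)
    (Omega : 'I_N -> R)
    (Omega_noninc : forall j k : 'I_N, (j <= k)%N -> Omega k <= Omega j)
    (Omega_neq0 : exists j : 'I_N, Omega j != 0)
    (Omega_sum0 : \sum_(j < N) Omega j = 0)
    (first last : 'I_N)
    (hfirst : nat_of_ord first = 0%N) (hlast : nat_of_ord last = N.-1)
    (kappas : R) (alpha : R -> 'I_N -> R) (lambda : R -> R)
    (hbranch : stable_branch Omega kappas alpha lambda) :
  (forall kappa : R, kappas <= kappa ->
    [/\ lambda kappa = order_parameter_norm (correlation (alpha kappa)),
        Num.sqrt 2 / 2 <= lambda kappa &
        alpha kappa first - alpha kappa last <=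
          2 * acos ((- N%:R + 2 + Num.sqrt (N%:R ^+ 2 - 4 * N%:R + 36)) / 8)])
  /\
  (alpha kappas first - alpha kappas last =
     2 * acos ((- N%:R + 2 + Num.sqrt (N%:R ^+ 2 - 4 * N%:R + 36)) / 8) ->
   lambda kappas =
     (3 * (N%:R - 2) + Num.sqrt (N%:R ^+ 2 - 4 * N%:R + 36)) / (4 * N%:R)).
Proof.
case: hbranch => k0 [hpl [hinc [_ [_ hcrit]]]].
have N0 : (0 < N)%N by apply: ltnW.
have n0 : 0 < N%:R :> R by rewrite ltr0n.
have n2 : 2 <= N%:R :> R by rewrite (ler_nat R 2 N).
have plc := hpl _ (lexx kappas).
have bd kappa : kappas <= kappa ->
    forall j, - (pi / 2) <= alpha kappa j <= pi / 2.
  by move=> /hpl[_ ha _ _ _] j; case: (ha j).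
have bdc := bd _ (lexx kappas).
have fl : first != last.
  by apply/eqP => /(congr1 val) /=; rewrite hfirst hlast; case: (N) hN => [|[]].
have Omax j : Omega j <= Omega first by apply: Omega_noninc; rewrite hfirst.
have Omin j : Omega last <= Omega j.
  by apply: Omega_noninc; rewrite hlast -ltnS prednK.
(* The largest of N numbers with sum 0 is nonnegative; dually for the smallest. *)
have Of : 0 <= Omega first.
  rewrite -(pmulr_rge0 _ n0) -Omega_sum0 mulr_natl -[X in _ *+ X](card_ord N).
  by rewrite -sumr_const; apply: ler_sum.
have Ol : Omega last <= 0.
  rewrite -(pmulr_rle0 _ n0) -Omega_sum0 mulr_natl -[X in _ *+ X](card_ord N).
  by rewrite -sumr_const; apply: ler_sum.
have [c0_gt0 c0E] := critical_root R N.
have [open_c open_eq] := critical_half_opening N0 bdc hcrit hN fl.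
set c0 := (_ / 8) in c0_gt0 c0E open_c open_eq *.
(* Since N >= 2 and [c0] > 0, [c0E] gives 4 [c0]^2 <= 2. *)
have c0_itv : -1 <= c0 <= 1 by nra.
have cK : cos (acos c0) = c0 by rewrite acosK // in_itv.
have acos_itv : acos c0 \in `[0, pi] by rewrite in_itv /= acos_ge0 ?acos_lepi.
split=> [kappa hk|hmax]; last first.
  have : cos ((alpha kappas first - alpha kappas last) / 2) = c0.
    by rewrite hmax mulrAC mulfV ?mul1r.
  move=> /open_eq lE; apply: (mulfI (lt0r_neq0 n0)); rewrite lE /c0; field.
  by rewrite gt_eqF.
have ple := hpl _ hk; have [l0 _ _ lE sE] := ple.
have lc : lambda kappas <= lambda kappa.
  by move: hk; rewrite le_eqVlt => /predU1P[-> //|hk]; apply/ltW/hinc.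
split.
- rewrite order_parameter_norm_correlation -lE sE expr0n addr0.
  by rewrite sqrtr_sqr gtr0_norm.
- exact: le_trans (critical_lambda_ge N0 bdc hcrit) lc.
have [/(_ Of) af _] := phase_locked_angle_shrink plc ple k0 hk lc first.
have [_ /(_ Ol) al] := phase_locked_angle_shrink plc ple k0 hk lc last.
(* By [af] and [al] the opening at [kappa] is at most the one at [kappas]. There, a half opening
   above [acos c0] would have cosine below [c0], as cosine decreases on [0, pi]. *)
suff : (alpha kappas first - alpha kappas last) / 2 <= acos c0 by lra.
rewrite leNgt; apply/negP => lt_open; move: open_c; apply/negP; rewrite -ltNge.
rewrite -cK ltr_cos // in_itv /=.
have := bdc first; have := bdc last; have := acos_ge0 c0_itv; lra.
Qed.
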